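(* Let $a_n$ ($n\ge1$) be the coefficients in the expansion $W(e^t)=\omega_0+\sum_{n=1}^\infty a_nt^n$ (equivalently, with $t=\ln x$, $W(x)=\omega_0+\sum_{n=1}^\infty a_n(\ln x)^n$). Then the coefficients are given by $$a_n=\frac{1}{n!}\sum_{k=0}^{n-1}\genfrac{\{}{\}}{0pt}{}{n+k-1}{k}_{\ge 2}\frac{(-1)^{k+1}\omega_0^k}{(1+\omega_0)^{n+k}}.$$
   Context: $W$ is the principal branch of the Lambert $W$ function and $\omega_0=W(1)=0.56714329\ldots$ is the Omega constant. $\genfrac{\{}{\}}{0pt}{}{n}{k}_{\ge 2}$ is the 2-associated Stirling number of the second kind (Stirling subset number): the number of partitions of an $n$-element set into $k$ blocks each of size at least $2$ (with value $1$ for $n=k=0$).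
   Formalization: The printed formula fails at n = 1, where it gives −1/(1+ω_0) instead of a_1 = ω_0/(1+ω_0); the formal statement adds 1 to the right-hand side when n = 1 and keeps the printed formula for all n ≥ 2. *)

(* Defs.v *)
From Stdlib Require Import Reals ClassicalEpsilon.
From Coquelicot Require Import Coquelicot.
From mathcomp Require Import all_boot.

Set Implicit Arguments.
Unset Strict Implicit.
Unset Printing Implicit Defensive.

Open Scope R_scope.

(* Real principal branch of the Lambert W function: for x >= -1/e it is the
   unique w >= -1 with w e^w = x; for x < -1/e the value is unspecified. *)
Definition LambertW (x : R) : R :=
  epsilon (inhabits 0) (fun w : R => -1 <= w /\ w * exp w = x).

Definition omega0 : R := LambertW 1.

(* A MathComp partition has no empty block; the empty family is a partition of
   the empty set, whence the value 1 at n = k = 0. *)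
Definition stirling2_ge2 (n k : nat) : nat :=
  #|[set P : {set {set 'I_n}} |
      [&& partition P [set: 'I_n], #|P| == k & [forall B in P, (2 <= #|B|)%N]]]|.

(* W(e^t) = omega0 + sum_(n >= 1) a_n t^n for all real t near 0; the entry a 0
   is not used. *)
Definition lambertW_exp_expansion (a : nat -> R) : Prop :=
  locally 0 (fun t : R =>
    is_series (fun n : nat => a n.+1 * t ^ n.+1) (LambertW (exp t) - omega0)).

(* Main.v *)
Require Import Defs.
From Stdlib Require Import Reals Lra ClassicalEpsilon.
From Coquelicot Require Import Coquelicot.
From mathcomp Require Import all_boot.

Open Scope R_scope.

(** Put U(t) = W(e^t). Taking logarithms in U e^U = e^t gives U + ln U = t, so
    wherever U is differentiable U' = U / (1 + U) = 1 - 1 / (1 + U). Applying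
    the operator (u / (1 + u)) d/du repeatedly to -1 / (1 + u) produces
    combinations of u^k / (1 + u)^(n + k), namely
<<
    (u / (1 + u)) d/du [u^k / (1 + u)^(n + k)]
      = k u^k / (1 + u)^(n + 1 + k) - (n + k) u^(k + 1) / (1 + u)^(n + 2 + k),
>>
    and, up to the sign (-1)^(k + 1), this is the recurrence
<<
    S(m + 1, k) = k S(m, k) + m S(m - 1, k - 1)      (m = n + k - 1)
>>
    of the 2-associated Stirling numbers ([stirling2_ge2_rec],
    [lambertW_deriv_telescope]). Hence the n-th derivative of U is the stated
    sum evaluated at U ([Derive_n_LambertW_exp]); the constant 1 in U' survives
    only for n = 1. At t = 0 one has U = omega0, and the n-th derivative of the
    sum of a power series at 0 is n! times its n-th coefficient. The
    differentiability of U near 0 comes from the expansion itself.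

    The recurrence is proved by summing over one distinguished block. Let A have
    m elements. Marking any block B of a partition of A into k + 1 blocks
    expresses (k + 1) S(m, k + 1) as the sum of S(m - |B|, k) over the B in A
    with at least 2 elements; for a new point x, choosing the rest B of the
    block of x expresses S(m + 1, k + 1) as the same sum over the nonempty B in
    A. The two differ by the m singletons. *)

(** * Partitions into blocks of size at least 2 *)

Section AssociatedPartitions.

Local Open Scope nat_scope.
Set Implicit Arguments.
Unset Strict Implicit.
Implicit Types T : finType.

Definition partitions_ge2 T (A : {set T}) (k : nat) : {set {set {set T}}} :=
  [set P | [&& partition P A, #|P| == k & [forall B in P, 2 <= #|B|]]].

(** Transport along the enumeration of A: the count depends on A only through
    its cardinal, which allows one to remove blocks from an index type. *)
Lemma card_partitions_ge2 T (A : {set T}) k :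
  #|partitions_ge2 A k| = stirling2_ge2 #|A| k.
Proof.
pose f := @enum_val T (mem A).
have inj_f : injective f by exact: enum_val_inj.
have im_f : f @: [set: 'I_#|A|] = A.
  apply/setP=> x; apply/imsetP/idP => [[i _ ->]|Ax]; first exact: enum_valP.
  by exists (enum_rank_in Ax x); rewrite ?inE // /f enum_rankK_in.
pose F (P : {set {set 'I_#|A|}}) := [set f @: B | B : {set _} in P].
have inj_F : injective F by apply: imset_inj; apply: imset_inj.
rewrite /stirling2_ge2 -(card_imset _ inj_F); congr #|pred_of_set _|.
have F_ge2 P : [forall B in F P, 2 <= #|B|] = [forall B in P, 2 <= #|B|].
  apply/forall_inP/forall_inP => ge2P B PB.
    by rewrite -(card_imset _ inj_f); apply: ge2P; rewrite imset_f.
  by case/imsetP: PB => C PC ->; rewrite card_imset // ge2P.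
have F_in P : (F P \in partitions_ge2 A k) =
    [&& partition P [set: 'I_#|A|], #|P| == k & [forall B in P, 2 <= #|B|]].
  rewrite inE F_ge2 -{1}im_f imset_partition //.
  by rewrite (card_imset _ (imset_inj inj_f)).
apply/setP=> P; apply/idP/imsetP => [PAk|[Q]]; last first.
  by rewrite inE -F_in => ? ->.
pose Q := [set f @^-1: (B : {set T}) | B : {set T} in P].
suff defP : P = F Q by exists Q; rewrite // inE -F_in -defP.
have partP : partition P A by move: PAk; rewrite inE => /and3P[].
rewrite /F -imset_comp -[LHS]imset_id; apply: eq_in_imset => B PB /=.
apply/setP=> x; apply/idP/imsetP => [Bx|[i] /[!inE] ? ->//].
have Ax : x \in A by apply: (subsetP (partitionS partP PB)).
by exists (enum_rank_in Ax x); rewrite ?inE /f enum_rankK_in.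
Qed.

(** Removing B is a bijection, with inverse the adjunction of B. *)
Lemma card_partitions_with_block T (A B : {set T}) k :
    B \subset A -> 2 <= #|B| ->
  #|[set P in partitions_ge2 A k.+1 | B \in P]| =
  #|partitions_ge2 (A :\: B) k|.
Proof.
move=> sBA B_ge2.
have B_neq0 : B != set0 by rewrite -card_gt0 (leq_trans _ B_ge2).
rewrite -(@card_in_imset _ _ (fun P => P :\ B)); last first.
  move=> P Q /[!inE] /andP[_ PB] /andP[_ QB] eqPQ.
  by rewrite -(setD1K PB) eqPQ setD1K.
congr #|pred_of_set _|; apply/setP=> Q; apply/imsetP/idP => [[P]|].
  rewrite !inE => /andP[/and3P[partP cardP /forall_inP ge2P] PB] ->.
  rewrite partitionD1 //= -eqSS -(eqP cardP) (cardsD1 B P) PB eqxx /=.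
  by apply/forall_inP=> C /setD1P[_]; apply: ge2P.
rewrite inE => /and3P[partQ /eqP cardQ /forall_inP ge2Q].
have QnB : B \notin Q.
  apply/negP=> QB; have := partitionS partQ QB.
  by rewrite subsetD => /andP[_]; rewrite -setI_eq0 setIid (negPf B_neq0).
have disjB : [disjoint B & A :\: B].
  by rewrite disjoint_sym disjoints_subset setDE subsetIr.
exists (B |: Q); last by rewrite setU1K.
rewrite !inE eqxx cardsU1 QnB cardQ eqxx andbT /=; apply/andP; split.
  have := partitionU1 partQ B_neq0 disjB.
  by rewrite -{2}(setIidPr sBA) setID.
by apply/forall_inP=> C /setU1P[->//|/ge2Q].
Qed.

(** Both sides count the partitions of A into k + 1 blocks with one marked
    block B, the right-hand side grouping them by B. *)
Lemma card_partitions_marked T (A : {set T}) k :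
  k.+1 * stirling2_ge2 #|A| k.+1 =
  \sum_(B : {set T} | (B \subset A) && (2 <= #|B|))
     stirling2_ge2 #|A :\: B| k.
Proof.
transitivity (\sum_(P in partitions_ge2 A k.+1) \sum_(B in P) 1).
  rewrite -card_partitions_ge2 mulnC -sum_nat_const; apply: eq_bigr => P.
  by rewrite inE sum1_card => /and3P[_ /eqP->].
rewrite (exchange_big_dep
  (fun B : {set T} => (B \subset A) && (2 <= #|B|))) /=; last first.
  move=> P B; rewrite inE => /and3P[partP _ /forall_inP ge2P] PB.
  by rewrite (partitionS partP PB) ge2P.
apply: eq_bigr => B /andP[sBA geB].
by rewrite -card_partitions_ge2 -card_partitions_with_block // sum1dep_card.
Qed.

(** The partitions of A with x adjoined are grouped by the block of x; here B is
    that block without x, so that it ranges over subsets of A as in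
    [card_partitions_marked]. *)
Lemma card_partitions_pblock T (A : {set T}) x k : x \notin A ->
  stirling2_ge2 #|A|.+1 k.+1 =
  \sum_(B : {set T} | (B \subset A) && (1 <= #|B|))
     stirling2_ge2 #|A :\: B| k.
Proof.
move=> xnA.
have -> : #|A|.+1 = #|x |: A| by rewrite cardsU1 xnA.
rewrite -card_partitions_ge2 -sum1_card.
rewrite (partition_big (fun P => pblock P x :\ x)
   (fun B : {set T} => (B \subset A) && (1 <= #|B|))) /=; last first.
  move=> P; rewrite inE => /and3P[partP _ /forall_inP ge2P].
  have Px : x \in cover P by rewrite (cover_partition partP) setU11.
  rewrite subDset (partitionS partP) ?pblock_mem //= -ltnS.
  by have := ge2P _ (pblock_mem Px); rewrite (cardsD1 x) mem_pblock Px.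
apply: eq_bigr => B /andP[sBA B_gt0].
have xnB : x \notin B by apply: contra xnA; apply: subsetP.
have -> : A :\: B = (x |: A) :\: (x |: B).
  apply/setP=> y; rewrite !inE; case: eqVneq => [->|//].
  by rewrite (negPf xnA) andbF.
rewrite -card_partitions_ge2 -card_partitions_with_block ?setUS //; last first.
  by rewrite cardsU1 xnB.
rewrite -sum1dep_card; apply: eq_bigl => P.
case: (boolP (P \in _)) => //=; rewrite inE => /and3P[partP _ _].
have Px : x \in cover P by rewrite (cover_partition partP) setU11.
apply/eqP/idP => [<-|PB].
  by rewrite setD1K ?pblock_mem // mem_pblock.
by rewrite (def_pblock (partition_trivIset partP) PB) ?setU11 // setU1K.
Qed.

(** Subtracting [card_partitions_marked] from [card_partitions_pblock] leaves the
    singletons B, one for each of the m elements of A. *)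
Lemma stirling2_ge2_rec m k :
  stirling2_ge2 m.+1 k.+1 =
  k.+1 * stirling2_ge2 m k.+1 + m * stirling2_ge2 m.-1 k.
Proof.
pose x : 'I_m.+1 := ord0; pose A := [set~ x].
have cardA : #|A| = m by rewrite cardsC1 card_ord.
have xnA : x \notin A by rewrite !inE eqxx.
have := card_partitions_pblock k xnA; have := card_partitions_marked A k.
rewrite cardA => -> ->.
rewrite (bigID (fun B : {set 'I_m.+1} => 2 <= #|B|)) /=; congr (_ + _).
  apply: eq_bigl => B; rewrite -andbA; congr (_ && _).
  by case: #|B| => [|[]].
transitivity (\sum_(B : {set 'I_m.+1} | (B \subset A) && (#|B| == 1))
   stirling2_ge2 m.-1 k).
  apply: eq_big => B; first by rewrite -andbA -leqNgt -eqn_leq eq_sym.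
  rewrite -andbA -leqNgt -eqn_leq => /andP[sBA /eqP B1].
  by rewrite cardsDS // cardA -B1 subn1.
by rewrite sum_nat_cond_const cards_draws cardA bin1.
Qed.

Lemma stirling2_ge2_small n k : n < k.*2 -> stirling2_ge2 n k = 0.
Proof.
move=> ltnk; apply/eqP; rewrite cards_eq0; apply/eqP/setP=> P; rewrite !inE.
apply/negP=> /and3P[partP /eqP cardP /forall_inP ge2P].
suff: k * 2 <= n by rewrite muln2 leqNgt ltnk.
rewrite -[n]card_ord -cardsT (card_partition partP) -cardP -sum_nat_const.
exact: leq_sum.
Qed.

Lemma stirling2_ge2_0 n : stirling2_ge2 n 0 = (n == 0).
Proof.
case: n => [|n]; last first.
  apply/eqP; rewrite cards_eq0; apply/eqP/setP=> P; rewrite !inE.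
  apply/negP=> /and3P[partP /eqP /cards0_eq P0 _].
  by have := card_partition partP; rewrite P0 big_set0 cardsT card_ord.
have -> : stirling2_ge2 0 0 = #|[set (set0 : {set {set 'I_0}})]|; last by rewrite cards1.
congr #|pred_of_set _|; apply/setP=> P; rewrite !inE.
rewrite cards_eq0; have -> : [set: 'I_0] = set0 by apply/setP=> -[].
rewrite partition_set0; case: eqP => //= ->.
by apply/forall_inP=> B; rewrite inE.
Qed.

End AssociatedPartitions.

(** * The differential equation of W(e^t) *)

(** The intermediate value theorem on [0, e^t] gives a solution w of
    w e^w = e^t, so the value selected by the definition of W solves this
    equation too; it is positive because e^t is, and logarithms can be taken. *)
Lemma LambertW_exp_spec t :
  0 < LambertW (exp t) /\ LambertW (exp t) + ln (LambertW (exp t)) = t.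
Proof.
have Et := exp_pos t.
have [w [w_ge wE]] : exists w, -1 <= w /\ w * exp w = exp t.
  have f_cont : continuity (fun w => w * exp w).
    by move=> x; apply: derivable_continuous_pt; reg.
  have f_le : exp t <= exp t * exp (exp t).
    by have := exp_ineq1_le (exp t); nra.
  have [|w [w_in wE]] := IVT_gen (fun w => w * exp w) 0 (exp t) (exp t) f_cont.
    rewrite Rmult_0_l Rmin_left ?Rmax_right; lra.
  by exists w; split=> //; move: w_in; rewrite Rmin_left; lra.
have [W_ge WE] : -1 <= LambertW (exp t) /\
    LambertW (exp t) * exp (LambertW (exp t)) = exp t.
  by apply: (epsilon_spec (inhabits 0)
    (fun w => -1 <= w /\ w * exp w = exp t)); exists w.
have W_gt0 : 0 < LambertW (exp t).
  by have := exp_pos (LambertW (exp t)); nra.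
split=> //; move: WE W_gt0; move: (LambertW _) => u uE u_gt0.
by rewrite -(ln_exp t) -uE ln_mult ?ln_exp //; [lra|exact: exp_pos].
Qed.

(** Differentiating W(e^t) + ln W(e^t) = t determines the derivative once it is
    known to exist. *)
Lemma LambertW_exp_derive t :
  ex_derive (fun s => LambertW (exp s)) t ->
  is_derive (fun s => LambertW (exp s)) t
    (1 - / (1 + LambertW (exp t))).
Proof.
set U := fun s => LambertW (exp s); move=> /Derive_correct.
move: (Derive U t) => l dU.
have [U_gt0 _] := LambertW_exp_spec t; rewrite -/(U t) in U_gt0 *.
have dE : is_derive (fun s => U s + ln (U s)) t (l + l * / U t).
  apply: (is_derive_plus U (fun s => ln (U s))) => //.
  by apply: (is_derive_comp ln U) => //; apply: is_derive_ln.
have dI : is_derive (fun s => U s + ln (U s)) t 1.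
  apply: (is_derive_ext (fun s => s)); last exact: is_derive_id.
  by move=> s; have [_ ->] := LambertW_exp_spec s.
have eq_l : l + l * / U t = 1.
  by rewrite -(is_derive_unique _ _ _ dE); apply: is_derive_unique.
suff -> : 1 - / (1 + U t) = l by [].
have -> : l = (l + l * / U t) * (U t / (1 + U t)) by field; lra.
rewrite eq_l; field; lra.
Qed.

(** * Higher derivatives *)

Definition lambertW_deriv_term (p k : nat) (u : R) : R :=
  INR (stirling2_ge2 (p + k)%N k) *
  ((-1) ^ k.+1 * u ^ k / (1 + u) ^ (p.+1 + k)%N).

(** The derivative of order p + 1 of W(e^t), less 1 if p = 0, as a function of
    u = W(e^t). *)
Definition lambertW_deriv (p : nat) (u : R) : R :=
  sum_n (fun k => lambertW_deriv_term p k u) p.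

(** The derivative in u of [lambertW_deriv_term p k]. *)
Definition lambertW_deriv_term' (p k : nat) (u : R) : R :=
  INR (stirling2_ge2 (p + k)%N k) * (-1) ^ k.+1 *
  (INR k * u ^ k.-1 / (1 + u) ^ (p.+1 + k)%N
   - INR (p.+1 + k)%N * u ^ k / (1 + u) ^ (p.+2 + k)%N).

Lemma lambertW_deriv_term_derive p k u : 0 < u ->
  is_derive (lambertW_deriv_term p k) u (lambertW_deriv_term' p k u).
Proof.
move=> u_gt0; rewrite /lambertW_deriv_term /lambertW_deriv_term'.
have pow_neq0 q : (1 + u) ^ q <> 0 by apply: pow_nonzero; lra.
rewrite !addSn; move: (p + k)%N => q; auto_derive; first exact: (pow_neq0 q.+1).
by rewrite /=; field; split; [exact: pow_neq0|lra].
Qed.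

(** The recurrence splits the coefficient of u^(k + 1) / (1 + u)^(p + 3 + k) in
    the next derivative into two parts, which come from differentiating the
    numerator of the term k + 1 and the denominator of the term k. A sum stopped
    at N therefore lacks exactly the numerator part of the term N + 1, which is
    the correction on the left. *)
Lemma lambertW_deriv_telescope p N u : 0 < u ->
  sum_n (fun k => lambertW_deriv_term' p k u) N * (u / (1 + u))
  + INR (stirling2_ge2 (p + N.+1)%N N.+1) * (-1) ^ N.+2 * INR N.+1 *
    u ^ N.+1 / (1 + u) ^ (p.+2 + N.+1)%N
  = sum_n (fun k => lambertW_deriv_term p.+1 k u) N.+1.
Proof.
move=> u_gt0.
have pow_neq0 q : (1 + u) ^ q <> 0 by apply: pow_nonzero; lra.
have termS k : lambertW_deriv_term p.+1 k.+1 u =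
    (INR k.+1 * INR (stirling2_ge2 (p + k.+1)%N k.+1) +
     INR (p.+1 + k) * INR (stirling2_ge2 (p + k)%N k)) *
    ((-1) ^ k.+2 * u ^ k.+1 / (1 + u) ^ (p.+2 + k.+1)%N).
  rewrite /lambertW_deriv_term addSn stirling2_ge2_rec plus_INR !mult_INR.
  by rewrite addnS addSn.
elim: N => [|N IHN].
  rewrite sum_Sn !sum_O termS /lambertW_deriv_term' /lambertW_deriv_term.
  rewrite !stirling2_ge2_0 /plus /= !addn0 !addn1 /=.
  field; split; [exact: pow_neq0|lra].
rewrite sum_Sn [RHS]sum_Sn -IHN termS /lambertW_deriv_term' /plus /=.
rewrite ?addSn ?addnS /=. field; split; [exact: pow_neq0|lra].
Qed.

(** For N = p the correction in [lambertW_deriv_telescope] vanishes: 2p + 1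
    points do not suffice for p + 1 blocks of size at least 2. *)
Lemma lambertW_deriv_derive p u : 0 < u ->
  exists2 l, is_derive (lambertW_deriv p) u l &
    l * (u / (1 + u)) = lambertW_deriv p.+1 u.
Proof.
move=> u_gt0; exists (sum_n (fun k => lambertW_deriv_term' p k u) p).
  apply: is_derive_sum_n => k _; exact: lambertW_deriv_term_derive.
rewrite -[RHS]lambertW_deriv_telescope //.
rewrite stirling2_ge2_small; last by rewrite -addnn ltn_add2r.
by rewrite /Rdiv !Rmult_0_l Rplus_0_r.
Qed.

(** Chain rule and induction. The equality has to hold on a neighbourhood of 0,
    not only at 0, for it to be differentiated again. *)
Lemma Derive_n_LambertW_exp p :
  locally 0 (ex_derive (fun s => LambertW (exp s))) ->
  locally 0 (fun t => Derive_n (fun s => LambertW (exp s)) p.+1 t =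
    (if p == 0%N then 1 else 0) + lambertW_deriv p (LambertW (exp t))).
Proof.
set U := fun s => LambertW (exp s) => exU.
elim: p => [|p IHp].
  apply: filter_imp exU => t /LambertW_exp_derive/is_derive_unique /= ->.
  rewrite /lambertW_deriv sum_O /lambertW_deriv_term stirling2_ge2_0 /=.
  have [U_gt0 _] := LambertW_exp_spec t; field; lra.
apply: filter_imp (filter_and _ _ (locally_locally _ _ IHp) exU) => t.
move=> [eqD /LambertW_exp_derive dU].
have [U_gt0 _] := LambertW_exp_spec t.
have [l dl lE] := lambertW_deriv_derive p U_gt0.
change (Derive (Derive_n U p.+1) t =
  (if p.+1 == 0%N then 1 else 0) + lambertW_deriv p.+1 (U t)).
rewrite (Derive_ext_loc _ _ _ eqD) /= -lE.
apply: is_derive_unique.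
have -> : 0 + l * (U t / (1 + U t)) = 0 + (1 - / (1 + U t)) * l.
  by field; rewrite /U; lra.
apply: (is_derive_plus (fun _ => _) (fun s => lambertW_deriv p (U s))).
  exact: is_derive_const.
exact: (is_derive_comp (lambertW_deriv p) U).
Qed.

(** * The coefficients *)

Lemma factE n : Factorial.fact n = n`!.
Proof. by elim: n => // n IHn; rewrite factS -IHn. Qed.

Theorem mainTheorem13 (a : nat -> R) (ha : lambertW_exp_expansion a)
    (n : nat) (hn : (1 <= n)%N) :
  a n = (if n == 1%N then 1 else 0) +
    / INR (n`!)%N *
    sum_n (fun k : nat =>
      INR (stirling2_ge2 (n + k - 1)%N k) *
      ((-1) ^ k.+1 * omega0 ^ k / (1 + omega0) ^ (n + k)%N)) (n - 1)%N.
Proof.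
pose U s := LambertW (exp s).
(* a 0 is arbitrary, so it is replaced by the constant term of the expansion. *)
pose b m := if m is m'.+1 then a m'.+1 else omega0.
have [eps b_series] : locally 0 (fun t => is_series (fun m => b m * t ^ m) (U t)).
  apply: filter_imp ha => t; rewrite -/(U t) => a_series.
  apply: is_series_decr_1.
  by rewrite /plus /opp /= Rmult_1_r.
have eps_gt0 := cond_pos eps.
(* Convergence at the single point eps / 2 already bounds the radius below. *)
have CV_b : Rbar_le (eps / 2) (CV_radius b).
  apply: Rbar_not_lt_le => lt_CV.
  apply: (CV_disk_outside b (eps / 2)).
    by rewrite Rabs_pos_eq //; lra.
  apply: ex_series_lim_0; exists (U (eps / 2)); apply: b_series.
  by rewrite /ball /= /AbsRing_ball /abs /minus /plus /opp /= Ropp_0 Rplus_0_r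
    Rabs_pos_eq; lra.
have bU : locally 0 (fun t => PSeries b t = U t).
  by exists eps => t /b_series/is_series_unique.
have exU : locally 0 (ex_derive U).
  have eps2_gt0 : 0 < eps / 2 by lra.
  have near0 : locally 0 (fun t => Rabs t < eps / 2).
    exists (mkposreal _ eps2_gt0) => t.
    by rewrite /ball /= /AbsRing_ball /abs /minus /plus /opp /= Ropp_0 Rplus_0_r.
  apply: filter_imp (filter_and _ _ (locally_locally _ _ bU) near0) => t [bUt t_lt].
  apply: (ex_derive_ext_loc (PSeries b)) => //.
  apply: ex_derive_PSeries; apply: Rbar_lt_le_trans CV_b; exact: t_lt.
case: n hn => // p _.
have CV_gt0 : Rbar_lt 0 (CV_radius b).
  by apply: Rbar_lt_le_trans CV_b => /=; lra.
have := Derive_n_coef b p.+1 CV_gt0.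
rewrite (Derive_n_ext_loc _ _ _ _ bU).
rewrite (locally_singleton _ _ (Derive_n_LambertW_exp p exU)) exp_0 -/omega0.
rewrite factE subn1 /= => coefE.
have fact_neq0 : INR (p.+1)`! <> 0.
  by apply: not_0_INR => f0; have := fact_gt0 p.+1; rewrite f0.
have -> : a p.+1 = a p.+1 * INR (p.+1)`! / INR (p.+1)`! by field.
rewrite -coefE /lambertW_deriv.
rewrite Rdiv_plus_distr; congr (_ + _).
  by case: (p) => [|m] /=; [field|rewrite /Rdiv Rmult_0_l].
rewrite [LHS]Rmult_comm; congr (_ * _).
apply: sum_n_ext => k; rewrite /lambertW_deriv_term.
by rewrite addSn subn1.
Qed.
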